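(* Let $n\ge 1$. (1) The multi-variable Tong-Yang-Ma matrix $\mathcal{TYM}_n(L)$ is an invariant of the $n$-string link $L$ (it depends only on the equivalence class of $L$). (2) For any $n$-string links $L$ and $L'$, $$\mathcal{TYM}_n(LL')=\mathcal{TYM}_n(L)\,\bigl(L\cdot\mathcal{TYM}_n(L')\bigr),$$ where $L\cdot$ denotes the entrywise action of $\mathcal{SL}_n$ on $\mathrm{GL}_n(\mathbb{Z}[\Lambda_n])$ determined by $L\cdot u_j=u_{\tau_L(j)}$ and $L\cdot v_j=v_{\tau_L(j)}$, with $\tau_L(j)=i_j$ when the string of $L$ ending at $z_j\times\{1\}$ is the $i_j$-th string.
   Context: String links. Fix points $z_1<\dots<z_n$ in $(-1,1)\times\{0\}\subset \mathrm{Int}(\mathbb{D}^2)$, $\mathbb{D}^2$ the unit disk. An $n$-string link is an embedding of a disjoint union of $n$ oriented intervals in $\mathbb{D}^2\times[0,1]$ such that each initial point is some $z_i\times\{0\}$ and each endpoint is some $z_j\times\{1\}$; the interval starting at $z_i\times\{0\}$ is the $i$-th string. String links are represented by planar diagrams, drawn with the points $z_i\times\{0\}$ at the top and $z_j\times\{1\}$ at the bottom, ordered from left to right. Two $n$-string links are equivalent if their diagrams are related by planar isotopy and finitely many Reidemeister moves R1, R2, R3. $\mathcal{SL}_n$ is the monoid of equivalence classes under concatenation ($LL'$ is $L$ followed by $L'$). $\Lambda_n$-groups. $\Lambda_n$ is the free abelian group (written multiplicatively) on $u_1,\dots,u_n,v_1,\dots,v_n$. A $\Lambda_n$-group is a group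 with a right action of $\Lambda_n$ by automorphisms, $(g,w)\mapsto g^w$. A $\Lambda_n$-presentation has, for each $\Lambda_n$-generator, a family of group generators indexed by $\Lambda_n\cong\mathbb{Z}^{2n}$ permuted by translation, and each $\Lambda_n$-relation stands for all its $\Lambda_n$-translates. Let $D$ be a diagram of $L$ with $N$ crossings. Cut every string at every crossing (both over and under), and label the resulting $n+2N$ edges; the top edges are $a_1,\dots,a_n$ and the bottom edges $x_1,\dots,x_n$ from left to right (if the same edge is top edge $i$ and bottom edge $j$, the relation $x_j=a_i$ is imposed). $K_n$ is the $\Lambda_n$-group with these labels as $\Lambda_n$-generators and the following $\Lambda_n$-relations at each crossing of sign $\varepsilon=\pm1$ where the $j$-th string passes over the $i$-th string (possibly $i=j$): if the under-string (the $i$-th) enters along edge $e$ and leaves along $e'$, and the over-string (the $j$-th) enters along $f$ and leaves along $f'$, then $e'=e^{u_j^{\varepsilon}}$ and $f'=f^{v_i^{\varepsilon}}$. Eliminating the other generators, $K_n=\langle a_1,\dots,a_n,x_1,\dots,x_n\mid x_j=a_{i_j}^{w_j},\ 1\le j\le n\rangle$ with $w_j\in\Lambda_n$. Define $\widetilde K_n=\langle a_1,\dots,a_n,x_1,\dots,x_n\mid x_j=a_{i_j}^{w_j(u_{i_j}v_{i_j})^{-k_j}},\ 1\le j\le n\rangle$, where $k_j$ is the sum of the signs of the self-crossings of the $i_j$-th string. The abelianization $\widetilde K_n^{\mathrm{ab}}$ is a free $\mathbb{Z}[\Lambda_n]$-module of rank $n$ with ordered bases $\mathcal S=(a_1,\dots,a_n)$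 and $\mathcal T=(x_1,\dots,x_n)$. The multi-variable Tong-Yang-Ma matrix $\mathcal{TYM}_n(L)\in \mathrm{GL}_n(\mathbb{Z}[\Lambda_n])$ is the change of basis matrix with $\mathcal S\,\mathcal{TYM}_n(L)=\mathcal T$, i.e. its $(i_j,j)$ entry is $w_j(u_{i_j}v_{i_j})^{-k_j}$ and all other entries are $0$. *)

(* Defs.v *)
From HB Require Import structures.
From mathcomp Require Import all_boot all_order all_fingroup all_algebra.
From mathcomp Require Import zify finmap.
From mathcomp.multinomials Require Import monalg.

Set Implicit Arguments.
Unset Strict Implicit.
Unset Printing Implicit Defensive.

Import GRing.Theory.

Local Open Scope ring_scope.

(* [malg] carries no ring structure over a group: its monoids have no
   nontrivial units. *)
Definition group_ring (G : zmodType) : Type := {malg int[G]}.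

HB.instance Definition _ (G : zmodType) := GRing.Zmodule.on (group_ring G).

Definition gr_mono (G : zmodType) (g : G) : group_ring G := << 1 *g g >>.

HB.lock Definition gr_mul (G : zmodType) (x y : group_ring G) : group_ring G :=
  \sum_(g <- msupp x) \sum_(h <- msupp y) << x@_g * y@_h *g g + h >>.
Canonical gr_mul_unlockable := Unlockable gr_mul.unlock.

Section GroupRing.
Variable G : zmodType.
Implicit Types (x y z : group_ring G) (d : {fset G}).

Lemma gr_mulEw d1 d2 x y : (msupp x `<=` d1)%fset -> (msupp y `<=` d2)%fset ->
  gr_mul x y = \sum_(g <- d1) \sum_(h <- d2) << x@_g * y@_h *g g + h >>.
Proof.
move=> le1 le2; rewrite unlock (big_fset_incl _ le1) /=.
  apply/eq_bigr=> g _; apply/big_fset_incl => // h _ /mcoeff_outdom ->.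
  by rewrite mulr0 monalgU0.
move=> g _ /mcoeff_outdom xg.
by rewrite big1 => // h _; rewrite xg mul0r monalgU0.
Qed.

Lemma gr_mulC : commutative (@gr_mul G).
Proof.
move=> x y; rewrite unlock exchange_big /=.
by apply/eq_bigr=> g _; apply/eq_bigr=> h _; rewrite mulrC addrC.
Qed.

Lemma gr_mulDl : left_distributive (@gr_mul G) +%R.
Proof.
move=> x y z; have sz := fsubset_refl (msupp z).
rewrite (gr_mulEw (msuppD_le x y) sz) (gr_mulEw (fsubsetUl _ (msupp y)) sz).
rewrite (gr_mulEw (fsubsetUr (msupp x) _) sz) -big_split /=.
apply/eq_bigr=> g _; rewrite -big_split /=; apply/eq_bigr=> h _.
by rewrite mcoeffD mulrDl monalgUD.
Qed.

Lemma gr_mulUU a b (g h : G) :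
  gr_mul << a *g g >> << b *g h >> = << a * b *g g + h >>.
Proof. by rewrite (gr_mulEw msuppU_le msuppU_le) !big_seq_fset1 !mcoeffUU. Qed.

Lemma gr_mul0 : left_zero 0 (@gr_mul G).
Proof. by move=> x; apply: (addIr (gr_mul 0 x)); rewrite -gr_mulDl !add0r. Qed.

Lemma gr_mul_suml (I : Type) (r : seq I) (F : I -> group_ring G) y :
  gr_mul (\sum_(i <- r) F i) y = \sum_(i <- r) gr_mul (F i) y.
Proof.
by elim/big_ind2: _ => [|x1 x2 y1 y2 <- <-|//]; rewrite ?gr_mul0 ?gr_mulDl.
Qed.

Lemma gr_mul_sumr (I : Type) (r : seq I) (F : I -> group_ring G) y :
  gr_mul y (\sum_(i <- r) F i) = \sum_(i <- r) gr_mul y (F i).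
Proof.
by rewrite gr_mulC gr_mul_suml; apply/eq_bigr=> i _; rewrite gr_mulC.
Qed.

Lemma gr_mulA : associative (@gr_mul G).
Proof.
move=> x y z; rewrite [x]monalgE !gr_mul_suml; apply/eq_bigr=> g _.
rewrite [y]monalgE gr_mul_suml !gr_mul_sumr gr_mul_suml; apply/eq_bigr=> h _.
rewrite [z]monalgE !gr_mul_sumr; apply/eq_bigr=> k _.
by rewrite !gr_mulUU mulrA addrA.
Qed.

Lemma gr_mul1 : left_id (gr_mono 0) (@gr_mul G).
Proof.
move=> x; rewrite gr_mulC [x]monalgE gr_mul_suml.
by apply/eq_bigr=> g _; rewrite gr_mulUU mulr1 addr0.
Qed.

Lemma gr_1_neq0 : gr_mono 0 != 0 :> group_ring G.
Proof. by apply/eqP=> /malgP/(_ 0); rewrite mcoeffUU mcoeff0. Qed.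

HB.instance Definition _ := GRing.Zmodule_isComNzRing.Build (group_ring G)
  gr_mulA gr_mulC gr_mul1 gr_mulDl gr_1_neq0.

Lemma gr_monoD (g h : G) : gr_mono (g + h) = gr_mono g * gr_mono h.
Proof. by rewrite [RHS]gr_mulUU mulr1. Qed.

Lemma gr_mono0 : gr_mono 0 = 1 :> group_ring G. Proof. by []. Qed.

End GroupRing.

Section Plane.
Variables (n : nat) (X : finType).

(* The strand of the crossing [c] on the layer [o], [true] being the upper one,
   is the port [inr (c, o)]. The port [inl i] is [z_i x {0}] as the beginning of
   an edge and [z_i x {1}] as the end of an edge. *)
Definition port : finType := ('I_n + X * bool)%type.

(* [(p, true)] is the half-edge leaving [p], [(p, false)] the one arriving. *)
Definition half : finType := (port * bool)%type.

Definition is_xing (p : port) : bool := if p is inr _ then true else false.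

Variables (sg : X -> bool) (nx : {perm port}).

Definition step : rel port := fun p q => (q == nx p) && is_xing q.

(* An edge is named by the port where it begins; it ends at its image by [nx]. *)
Definition on_string (i : 'I_n) (p : port) : bool := connect step (inl i) p.

Definition along (h : half) : half :=
  if h.2 then (nx h.1, false) else ((nx^-1)%g h.1, true).

(* The half-edge that follows clockwise around a crossing, or around the
   boundary of the disk collapsed to a point. At a positive crossing the
   clockwise order is: over out, under in, over in, under out; at a negative
   one: under out, over in, under in, over out. *)
Definition turn (h : half) : half :=
  match h with
  | (inl i, true) =>
      if val i == 0 then (inl i, false) else (inl (ord_pred i), true)
  | (inl i, false) =>
      if i.+1 == n then (inl i, true) else (inl (ordS i), false)
  | (inr (c, o), d) => (inr (c, ~~ o), d (+) (o == sg c))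
  end.

Lemma alongK : involutive along.
Proof. by case=> p []; rewrite /along /= ?permK ?permKV. Qed.

Lemma turn_inj : injective turn.
Proof.
have S0 (i : 'I_n) : i.+1 != n -> val (ordS i) != 0.
  by move=> ne; rewrite /= modn_small // ltn_neqAle ne ltn_ord.
have P0 (i : 'I_n) : val i != 0 -> (ord_pred i).+1 != n.
  case: i => -[|i] //= lt_in _; rewrite modnDr modn_small ?(ltnW lt_in) //.
  by rewrite neq_ltn lt_in.
pose pos (h : half) := if h.1 is inl k then val k else 0.
case=> [[i|[c o]] d] [[j|[c' o']] d'] /=; last first.
- by case=> <- /negb_inj <- /addIb ->.
- by case: d' => /=; case: ifP.
- by case: d => /=; case: ifP.
case: d d' => [] [] /=; do 2?case: ifPn => //.
- by move=> _ _ [->].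
- by move=> _ _ [/(@ord_inj n (ord_pred i) (ord_pred j))/(can_inj (@ord_predK n)) ->].
- move=> /S0 nz i0 e; have {}e : val i = val (ordS j) := congr1 pos e.
  by rewrite -e i0 in nz.
- move=> jn /P0 nz e; have {}e : val (ord_pred i) = val j := congr1 pos e.
  by rewrite [X in X.+1]e jn in nz.
- move=> /P0 nz i_n e; have {}e : val i = val (ord_pred j) := congr1 pos e.
  by rewrite -[X in X.+1]e i_n in nz.
- move=> j0 /S0 nz e; have {}e : val (ordS i) = val j := congr1 pos e.
  by rewrite e j0 in nz.
- by move=> _ _ [->].
- by move=> _ _ [/(@ord_inj n (ordS i) (ordS j))/(can_inj (@ordSK n)) ->].
Qed.

Lemma face_inj : injective (turn \o along).
Proof. exact: inj_comp turn_inj (can_inj alongK). Qed.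

(* Walks around a face keeping it on the left: the next half-edge along which
   the walk leaves a vertex. *)
Definition face : {perm half} := perm face_inj.

End Plane.

(* The diagrams up to planar isotopy: every edge is connected to the boundary,
   so that collapsing the boundary of the disk to a point gives a connected
   plane map, with [#|xing| + 1] vertices and [n + 2 * #|xing|] edges. Its genus
   vanishes when there are [#|xing| + n + 1] faces; there are never more. *)
Record diagram (n : nat) : Type := Diagram {
  xing : finType;
  sgn : xing -> bool;
  nxt : {perm port n xing};
  string_cover : forall p, exists i, on_string nxt i p;
  planar : (#|xing| + n + 1 <= #|porbits (face sgn nxt)|)%N
}.

Arguments xing {n} d.
Arguments sgn {n} d.
Arguments nxt {n} d.

Section Concatenation.
Variables (n : nat) (D E : diagram n).
Local Notation X := (xing D + xing E)%type.

Definition portl (p : port n (xing D)) : port n X :=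
  match p with inl i => inl i | inr (c, o) => inr (inl c, o) end.

Definition portr (p : port n (xing E)) : port n X :=
  match p with inl i => inl i | inr (c, o) => inr (inr c, o) end.

(* An edge of [D] that ends at the bottom point [k] continues as the edge of
   [E] that begins at the top point [k]. *)
Definition glue (p : port n (xing D)) : port n X :=
  match p with inl k => portr (nxt E (inl k)) | inr _ => portl p end.

Definition cat_next_fun (p : port n X) : port n X :=
  match p with
  | inl i => glue (nxt D (inl i))
  | inr (inl c, o) => glue (nxt D (inr (c, o)))
  | inr (inr c, o) => portr (nxt E (inr (c, o)))
  end.

Definition cat_sgn (c : X) : bool :=
  match c with inl c => sgn D c | inr c => sgn E c end.

Lemma portl_inj : injective portl.
Proof. by case=> [i|[c o]] [j|[c' o']] //= [->] // ->. Qed.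

Lemma portr_inj : injective portr.
Proof. by case=> [i|[c o]] [j|[c' o']] //= [->] // ->. Qed.

Lemma glue_inj : injective glue.
Proof.
case=> [i|[c o]] [j|[c' o']] /=.
- by move/portr_inj/perm_inj=> [->].
- by case: (nxt E _) => [?|[]].
- by case: (nxt E _) => [?|[]].
- by case=> -> ->.
Qed.

Lemma cat_next_portl p : cat_next_fun (portl p) = glue (nxt D p).
Proof. by case: p => [i|[c o]]. Qed.

Lemma portE p : {p1 | p = portl p1} + {x | p = portr (inr x)}.
Proof.
case: p => [i|[[c|c] o]]; first by left; exists (inl i).
  by left; exists (inr (c, o)).
by right; exists (c, o).
Qed.

Lemma glue_portr q x : glue q <> portr (nxt E (inr x)).
Proof.
case: q => [k|[c o]] /=; first by move/portr_inj/perm_inj.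
by case: (nxt E _) => [?|[]].
Qed.

Lemma cat_next_portr x : cat_next_fun (portr (inr x)) = portr (nxt E (inr x)).
Proof. by case: x. Qed.

Lemma cat_next_inj : injective cat_next_fun.
Proof.
move=> p q; have [[p1 ->]|[x ->]] := portE p; have [[q1 ->]|[y ->]] := portE q.
- by rewrite !cat_next_portl => /glue_inj/perm_inj ->.
- by rewrite cat_next_portl cat_next_portr => /glue_portr.
- by rewrite cat_next_portl cat_next_portr => /esym/glue_portr.
- by rewrite !cat_next_portr => /portr_inj/perm_inj ->.
Qed.

Definition cat_next : {perm port n X} := perm cat_next_inj.

Lemma cat_nextl p : cat_next (portl p) = glue (nxt D p).
Proof. by rewrite permE cat_next_portl. Qed.

(* The edge of the concatenation that contains a given edge of [E]. *)
Definition edger (p : port n (xing E)) : port n X :=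
  match p with inl k => portl ((nxt D)^-1%g (inl k)) | inr _ => portr p end.

Lemma cat_next_edger p : cat_next (edger p) = portr (nxt E p).
Proof.
case: p => [k|x]; last by rewrite permE cat_next_portr.
by rewrite cat_nextl permKV.
Qed.

Lemma connect_homo (T1 T2 : finType) (e1 : rel T1) (e2 : rel T2) (f : T1 -> T2) :
  {homo f : x y / e1 x y >-> e2 x y} ->
  {homo f : x y / connect e1 x y >-> connect e2 x y}.
Proof.
move=> fh x _ /connectP[p + ->]; elim: p x => [|y p IH] x //= /andP[exy /IH].
exact/connect_trans/connect1/fh.
Qed.

Lemma step_portl : {homo portl : p q / step (nxt D) p q >-> step cat_next p q}.
Proof.
move=> p q /andP[/eqP-> h]; rewrite /step cat_nextl.
by case: (nxt D p) h => [//|[c o]] _ /=; rewrite eqxx.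
Qed.

Lemma step_edger : {homo edger : p q / step (nxt E) p q >-> step cat_next p q}.
Proof.
move=> p q /andP[/eqP-> h]; rewrite /step cat_next_edger.
by case: (nxt E p) h => [//|[c o]] _ /=; rewrite eqxx.
Qed.

Lemma cat_cover_portl p : exists i, on_string cat_next i (portl p).
Proof.
by have [i ip] := string_cover p; exists i; exact: (connect_homo step_portl ip).
Qed.

Lemma cat_cover p : exists i, on_string cat_next i p.
Proof.
have [[p1 ->]|[x ->]] := portE p; first exact: cat_cover_portl.
have [k kx] := string_cover (inr x : port n (xing E)).
have [i ik] := cat_cover_portl ((nxt D)^-1%g (inl k)).
exists i; apply: connect_trans ik _; exact: (connect_homo step_edger kx).
Qed.

End Concatenation.

Lemma merge_classes (T K : finType) (f : T -> K) (ps : seq (T * T)) :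
  exists g : T -> K,
    [/\ forall x y, f x = f y -> g x = g y,
        {in ps, forall ab, g ab.1 = g ab.2} &
        (#|[set f x | x : T]| <= #|[set g x | x : T]| + size ps)%N].
Proof.
elim: ps => [|[a b] ps [g [fg gps le]]]; first by exists f; rewrite addn0.
exists (fun x => if g x == g b then g a else g x); split.
- by move=> x y /fg ->.
- move=> ab; rewrite inE => /predU1P[->|/gps ->] //=; rewrite eqxx.
  by case: ifP.
apply: leq_trans le _; rewrite /= addnS -addSn leq_add2r -add1n.
rewrite -(cards1 (g b)); apply: leq_trans (leq_of_leqif (leq_card_setU _ _)).
apply/subset_leq_card/subsetP=> _ /imsetP[x _ ->]; rewrite !inE.
have [//|ne] := eqVneq (g x) (g b); apply/orP; right.
by apply/imsetP; exists x => //; rewrite (negPf ne).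
Qed.

Lemma porbits_ge_invariant (T K : finType) (s : {perm T}) (h : T -> K) :
  (forall x, h (s x) = h x) -> (#|[set h x | x : T]| <= #|porbits s|)%N.
Proof.
move=> hs; have hX k x : h ((s ^+ k)%g x) = h x.
  by elim: k => [|k IH]; rewrite ?expg0 ?perm1 // expgSr permM hs.
pose H (O : {set T}) := omap h [pick x in O].
apply: leq_trans (leq_imset_card H (porbits s)).
have SomeI : injective (@Some K) by move=> ? ? [].
rewrite -(card_imset (mem [set h x | x : T]) SomeI).
apply/subset_leq_card/subsetP=> _ /imsetP[_ /imsetP[x _ ->] ->].
apply/imsetP; exists (porbit s x); first exact: imset_f.
rewrite /H; case: pickP => [y /porbitP[k ->]|/(_ x)]; first by rewrite /= hX.
by rewrite porbit_id.
Qed.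

Section CatPlanar.
Variables (n : nat) (D E : diagram n).
Local Notation X := (xing D + xing E)%type.
Local Notation hD := (half n (xing D)).
Local Notation hE := (half n (xing E)).
Local Notation face' := (face (@cat_sgn n D E) (cat_next D E)).

Let split_half (h : half n X) : hD + hE :=
  match h with
  | (inl i, true) => inl (inl i, true)
  | (inl i, false) => inr (inl i, false)
  | (inr (inl c, o), d) => inl (inr (c, o), d)
  | (inr (inr c, o), d) => inr (inr (c, o), d)
  end.

Lemma cat_planar :
  (#|{: X}| + n + 1 <= #|porbits face'|)%N.
Proof.
have [n0|n_gt0] := posnP n.
  have no (p : port n (xing D)) : False.
    by have [[i lt_i] _] := string_cover p; rewrite n0 in lt_i.
  suff: (#|porbits (face (sgn D) (nxt D))| <= 0)%N.
    by move/(leq_trans (planar D)); rewrite addn1.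
  apply: leq_trans (leq_imset_card _ _) _; rewrite leqn0.
  by apply/eqP/eq_card0=> -[p d]; case: (no p).
have lt_last : (n.-1 < n)%N by rewrite prednK.
pose last : 'I_n := Ordinal lt_last.
pose bot k : hD + hE := inl (inl k, false).
pose top k : hD + hE := inr (inl k, true).
pose ps : seq ((hD + hE) * (hD + hE)) :=
  (inl (inl last, true), inr (inl last, true)) ::
    [seq (bot k, inr (turn (sgn E) (inl k, true))) | k : 'I_n].
pose f (x : hD + hE) : {set hD} + {set hE} :=
  match x with
  | inl x => inl (porbit (face (sgn D) (nxt D)) x)
  | inr x => inr (porbit (face (sgn E) (nxt E)) x)
  end.
have [g [fg gps le_g]] := merge_classes f ps.
have gap_last : g (inl (inl last, true)) = g (inr (inl last, true)).
  by apply: (gps (_, _)); rewrite mem_head.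
have gap k : g (bot k) = g (inr (turn (sgn E) (inl k, true))).
  by apply: (gps (_, _)); rewrite inE image_f ?orbT.
have gD y : g (inl (turn (sgn D) y)) = g (inl (along (nxt D) y)).
  apply: fg; congr inl; rewrite -{1}(alongK (nxt D) y).
  have -> x : turn (sgn D) (along (nxt D) x) = face (sgn D) (nxt D) x.
    by rewrite permE.
  by have := porbit_perm (face (sgn D) (nxt D)) 1 (along (nxt D) y); rewrite expg1.
have gE y : g (inr (turn (sgn E) y)) = g (inr (along (nxt E) y)).
  apply: fg; congr inr; rewrite -{1}(alongK (nxt E) y).
  have -> x : turn (sgn E) (along (nxt E) x) = face (sgn E) (nxt E) x.
    by rewrite permE.
  by have := porbit_perm (face (sgn E) (nxt E)) 1 (along (nxt E) y); rewrite expg1.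
have g_bot k : g (bot k) = g (inr (along (nxt E) (inl k, true))).
  by rewrite gap gE.
have gap0 k : val k = 0 -> g (bot k) = g (inr (inl k, false)).
  by move=> k0; rewrite gap /turn k0.
have gap_n (k : 'I_n) : k.+1 = n -> g (inl (inl k, true)) = g (inr (inl k, true)).
  by move=> kn; have -> : k = last by exact/val_inj/(congr1 predn kn).
have g_top k : g (top k) = g (inl (along (nxt D) (inl k, false))).
  rewrite -gD /=; case: eqP => [kn|/eqP kn].
    by rewrite gap_n.
  have := gap (ordS k); rewrite /bot => ->; congr (g (inr _)).
  by rewrite /turn ordSK; case: eqP => // /eqP; rewrite /= modn_small // ltn_neqAle kn ltn_ord.
pose h x := g (split_half x).
pose turns (z : hD + hE) : hD + hE := match z with
  inl y => inl (turn (sgn D) y) | inr y => inr (turn (sgn E) y) end.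
pose alongs (z : hD + hE) : hD + hE := match z with
  inl y => inl (along (nxt D) y) | inr y => inr (along (nxt E) y) end.
have g_turns z : g (turns z) = g (alongs z) by case: z.
have splitl p : split_half (portl E p, true) = inl (p, true).
  by case: p => [|[]].
have splitr p : split_half (portr D p, false) = inr (p, false).
  by case: p => [|[]].
have h_turn y : h (turn (@cat_sgn n D E) y) = g (turns (split_half y)).
  case: y => [[i|[[c|c] o]] []] //; rewrite /h /turns /turn /=.
    by case: (eqVneq (val i) 0) => // /gap0.
  by case: eqP => // /gap_n.
have h_along y : h (along (cat_next D E) y) = g (alongs (split_half y)).
  case: y => p [].
    have [[p1 ->]|[x ->]] := portE p.
      rewrite /h /along [_.2]/= [_.1]/= cat_nextl splitl.
      rewrite -[alongs _]/(inl (nxt D p1, false)).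
      case: (nxt D p1) => [k|[c o]] //.
      by rewrite /glue splitr -[RHS]/(g (bot k)) g_bot.
    rewrite -[LHS]/(g (split_half (cat_next D E (edger D (inr x)), false))).
    by rewrite cat_next_edger splitr; case: x.
  have along_edger q : h (along (cat_next D E) (portr D q, false)) =
      g (inr (along (nxt E) (q, false))).
    rewrite -[RHS]/(g (inr ((nxt E)^-1%g q, true))).
    rewrite -[LHS]/(g (split_half ((cat_next D E)^-1%g (portr D q), true))).
    rewrite -{1}(permKV (nxt E) q) -cat_next_edger permK.
    case: ((nxt E)^-1%g q) => [k|[c o]] //.
    by rewrite [edger _ _]/(portl E _) splitl -[RHS]/(g (top k)) g_top.
  case: p => [j|[[c|c] o]]; first exact: (along_edger (inl j)); last first.
    exact: (along_edger (inr (c, o))).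
  rewrite -[LHS]/(g (split_half ((cat_next D E)^-1%g (inr (inl c, o)), true))).
  have e : inr (inl c, o) = cat_next D E (portl E ((nxt D)^-1%g (inr (c, o)))).
    by rewrite cat_nextl permKV.
  by rewrite {1}e permK splitl.
have h_face x : h (face' x) = h x.
  rewrite permE /= h_turn g_turns -h_along alongK //.
have h_in y : h y \in [set h y | y : half n X] by apply: imset_f.
have h_im x : g x \in [set h y | y : half n X].
  case: x => [[[k|[c o]] d]|[[k|[c o]] d]].
  - case: d; first exact: (h_in (inl k, true)).
    rewrite -[inl _]/(bot k) g_bot -[along _ _]/(nxt E (inl k), false) -splitr.
    exact: h_in.
  - exact: (h_in (inr (inl c, o), d)).
  - case: d; last exact: (h_in (inl k, false)).
    rewrite -[inr _]/(top k) g_top.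
    rewrite -[along _ _]/((nxt D)^-1%g (inl k), true) -splitl; exact: h_in.
  - exact: (h_in (inr (inr c, o), d)).
have le_gh : (#|[set g x | x : hD + hE]| <= #|porbits face'|)%N.
  apply: leq_trans (porbits_ge_invariant h_face).
  by apply/subset_leq_card/subsetP=> _ /imsetP[x _ ->].
have le_f : (#|porbits (face (sgn D) (nxt D))| +
             #|porbits (face (sgn E) (nxt E))| <= #|[set f x | x : hD + hE]|)%N.
  have inlI : injective (@inl {set hD} {set hE}) by move=> ? ? [].
  have inrI : injective (@inr {set hD} {set hE}) by move=> ? ? [].
  rewrite -(card_imset _ inlI) -(card_imset _ inrI) -cardsUI.
  rewrite [X in (_ + X)%N]eq_card0 ?addn0; last first.
    by move=> z; rewrite !inE; apply/andP=> -[/imsetP[? _ ->] /imsetP[]].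
  apply/subset_leq_card/subsetP=> z; rewrite inE.
  case/orP=> /imsetP[_ /imsetP[x _ ->] ->]; first exact: (imset_f f (x := inl x)).
  exact: (imset_f f (x := inr x)).
have size_ps : size ps = n.+1 by rewrite /= size_image card_ord.
rewrite size_ps in le_g.
have := leq_trans le_f (leq_trans le_g (leq_add le_gh (leqnn _))).
move/(leq_trans (leq_add (planar D) (planar E))).
rewrite card_sum; lia.
Qed.
End CatPlanar.

(* [L] followed by [L'], with [L] drawn above [L']. *)
Definition cat_diagram (n : nat) (D E : diagram n) : diagram n :=
  Diagram (@cat_cover n D E) (cat_planar D E).

(* [Lambda_n], written additively: [w (inl i)] and [w (inr i)] are the exponents
   of [u_i] and [v_i]. *)
Definition Lambda (n : nat) : zmodType := {ffun 'I_n + 'I_n -> int}.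

Definition gen_u (n : nat) (i : 'I_n) : Lambda n := [ffun s => (s == inl i)%:R].
Definition gen_v (n : nat) (i : 'I_n) : Lambda n := [ffun s => (s == inr i)%:R].

Definition ZLambda (n : nat) := group_ring (Lambda n).

Section StringLink.
Variables (n : nat) (D : diagram n).

Definition string_of (p : port n (xing D)) : 'I_n := xchoose (string_cover p).

Definition edge_a (i : 'I_n) : port n (xing D) := inl i.
Definition edge_x (j : 'I_n) : port n (xing D) := (nxt D)^-1%g (inl j).

Definition tau (j : 'I_n) : 'I_n := string_of (edge_x j).

Definition eps (c : xing D) : int := if sgn D c then 1 else -1.

(* The exponent picked up on the layer [x.2] of the crossing [x.1]: [v_i^eps]
   on the over-strand and [u_j^eps] on the under-strand, where the [j]-th string
   passes over the [i]-th. *)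
Definition label (x : xing D * bool) : Lambda n :=
  (if x.2 then gen_v (string_of (inr (x.1, false)))
   else gen_u (string_of (inr (x.1, true)))) *~ eps x.1.

Definition w_exp (j : 'I_n) : Lambda n :=
  \sum_(x | string_of (inr x) == tau j) label x.

Definition self_writhe (i : 'I_n) : int :=
  \sum_(c | (string_of (inr (c, true)) == i) && (string_of (inr (c, false)) == i))
    eps c.

Definition wtilde_exp (j : 'I_n) : Lambda n :=
  w_exp j - (gen_u (tau j) + gen_v (tau j)) *~ self_writhe (tau j).

Definition TYM : 'M[ZLambda n]_n :=
  \matrix_(i, j) if i == tau j then gr_mono (wtilde_exp j) else 0.

End StringLink.

Arguments tau {n} D.
Arguments TYM {n} D.

Definition Lambda_act (n : nat) (t : 'I_n -> 'I_n) (w : Lambda n) : Lambda n :=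
  \sum_i (gen_u (t i) *~ w (inl i) + gen_v (t i) *~ w (inr i)).

Definition ZLambda_act (n : nat) (t : 'I_n -> 'I_n) (x : ZLambda n) : ZLambda n :=
  \sum_(w <- msupp x) << x@_w *g Lambda_act t w >>.

Lemma Lambda_act_gen_u (n : nat) (t : 'I_n -> 'I_n) j :
  Lambda_act t (gen_u j) = gen_u (t j).
Proof.
rewrite /Lambda_act (bigD1 j) //= big1 => [|i ne].
  by rewrite !ffunE eqxx mulr1z mulr0z !addr0.
by rewrite !ffunE (inj_eq (@inl_inj _ _)) (negPf ne) !mulr0z addr0.
Qed.

Lemma Lambda_act_gen_v (n : nat) (t : 'I_n -> 'I_n) j :
  Lambda_act t (gen_v j) = gen_v (t j).
Proof.
rewrite /Lambda_act (bigD1 j) //= big1 => [|i ne].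
  by rewrite !ffunE eqxx mulr1z mulr0z add0r addr0.
by rewrite !ffunE (inj_eq (@inr_inj _ _)) (negPf ne) !mulr0z addr0.
Qed.

Lemma Lambda_actD (n : nat) (t : 'I_n -> 'I_n) :
  {morph @Lambda_act n t : w w' / w + w'}.
Proof.
move=> w w'; rewrite /Lambda_act -big_split; apply: eq_bigr => i _ /=.
by rewrite !ffunE !mulrzDr addrACA.
Qed.

Lemma ZLambda_actEw (n : nat) (t : 'I_n -> 'I_n) (d : {fset Lambda n})
    (x : ZLambda n) : (msupp x `<=` d)%fset ->
  ZLambda_act t x = \sum_(w <- d) << x@_w *g Lambda_act t w >>.
Proof.
move=> le; rewrite /ZLambda_act; apply: big_fset_incl => // w _ /mcoeff_outdom ->.
by rewrite monalgU0.
Qed.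

Lemma ZLambda_act_mono (n : nat) (t : 'I_n -> 'I_n) (c : int) (w : Lambda n) :
  ZLambda_act t << c *g w >> = << c *g Lambda_act t w >>.
Proof. by rewrite (ZLambda_actEw t msuppU_le) big_seq_fset1 mcoeffUU. Qed.

Lemma ZLambda_actD (n : nat) (t : 'I_n -> 'I_n) :
  {morph @ZLambda_act n t : x y / x + y}.
Proof.
move=> x y; rewrite (ZLambda_actEw t (msuppD_le x y)).
rewrite (ZLambda_actEw t (fsubsetUl _ (msupp y))).
rewrite (ZLambda_actEw t (fsubsetUr (msupp x) _)) -big_split /=.
by apply: eq_bigr => w _; rewrite mcoeffD monalgUD.
Qed.

Lemma ZLambda_act_sum (n : nat) (t : 'I_n -> 'I_n) (I : Type) (r : seq I)
    (F : I -> ZLambda n) :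
  ZLambda_act t (\sum_(i <- r) F i) = \sum_(i <- r) ZLambda_act t (F i).
Proof.
apply: (big_morph _ (@ZLambda_actD n t)).
by rewrite /ZLambda_act msupp0 big_seq_fset0.
Qed.

Lemma ZLambda_actM (n : nat) (t : 'I_n -> 'I_n) :
  {morph @ZLambda_act n t : x y / x * y}.
Proof.
move=> x y; rewrite [x]monalgE [y]monalgE mulr_suml !ZLambda_act_sum mulr_suml.
apply: eq_bigr => w _; rewrite !mulr_sumr ZLambda_act_sum; apply: eq_bigr => w' _.
by rewrite [_ * _]gr_mulUU !ZLambda_act_mono [RHS]gr_mulUU Lambda_actD.
Qed.

Definition sl_act (n : nat) (D : diagram n) (M : 'M[ZLambda n]_n) :
    'M[ZLambda n]_n :=
  map_mx (ZLambda_act (tau D)) M.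

Section Moves.
Variable n : nat.
Implicit Types D E : diagram n.

Definition port_map (X Y : finType) (f : X -> Y) (p : port n X) : port n Y :=
  match p with inl i => inl i | inr (c, o) => inr (f c, o) end.

(* [E] is [D] without the crossings in [S], each strand through them becoming
   part of a single edge. *)
Definition erases D (S : {set xing D}) E : Prop :=
  exists f : xing E -> xing D,
    [/\ injective f, forall c, c \in S <-> (forall c', f c' <> c),
        forall c, sgn D (f c) = sgn E c &
        forall p, exists k,
          iter k.+1 (nxt D) (port_map f p) = port_map f (nxt E p) /\
          forall i, (i < k)%N ->
            exists c o, c \in S /\ iter i.+1 (nxt D) (port_map f p) = inr (c, o)].

Definition planar_isotopic D E : Prop :=
  exists f : xing D -> xing E,
    [/\ bijective f, forall c, sgn E (f c) = sgn D c &
        forall p, nxt E (port_map f p) = port_map f (nxt D p)].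

(* The two directions along the edge [p], as half-edges leaving a vertex. *)
Definition sides D (p : port n (xing D)) : seq (half n (xing D)) :=
  [:: (p, true); (nxt D p, false)].

Local Notation fc D := (face (sgn D) (nxt D)).

Definition over D (c : xing D) : port n (xing D) := inr (c, true).
Definition under D (c : xing D) : port n (xing D) := inr (c, false).

(* [p] is the edge between the consecutive ports [q] and [r], in either
   direction. *)
Definition joins D (p q r : port n (xing D)) : Prop :=
  (p = q /\ nxt D p = r) \/ (p = r /\ nxt D p = q).

(* The loop bounds a face since it meets no other crossing. *)
Definition reidemeister1 D E : Prop :=
  exists c o, nxt D (inr (c, o)) = inr (c, ~~ o) /\ erases [set c] E.

(* [p1] and [p2] are the two sides of a bigon between [c] and [d]. *)
Definition reidemeister2 D E : Prop :=
  exists c d p1 p2,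
    [/\ c != d,
        joins p1 (over c) (over d) /\ joins p2 (under c) (under d),
        exists h1 h2, [/\ h1 \in sides p1, h2 \in sides p2,
                          fc D h1 = h2 & fc D h2 = h1] &
        erases [set c; d] E].

(* The top strand crosses the middle one at [a] and the bottom one at [b], the
   middle one crosses the bottom one at [c], and the edges [p1], [p2], [p3] of
   these strands bound a triangle. The move reverses the order in which each
   strand meets its two crossings. *)
Definition reidemeister3 D E : Prop :=
  exists a b c p1 p2 p3,
    [/\ uniq [:: a; b; c],
        [/\ joins p1 (over a) (over b), joins p2 (under a) (over c) &
            joins p3 (under b) (under c)],
        exists h1 h2 h3,
          [/\ h1 \in sides p1,
              (h2 \in sides p2 /\ h3 \in sides p3) \/
              (h2 \in sides p3 /\ h3 \in sides p2),
              fc D h1 = h2, fc D h2 = h3 & fc D h3 = h1] &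
        let swap := (tperm (over a) (over b) * tperm (under a) (over c)
                     * tperm (under b) (under c))%g in
        exists f : xing D -> xing E,
          [/\ bijective f, forall x, sgn E (f x) = sgn D x &
              forall p, nxt E (port_map f (swap p)) =
                        port_map f (swap (nxt D p))]].

Inductive string_link_equiv : diagram n -> diagram n -> Prop :=
| sl_isotopy D E : planar_isotopic D E -> string_link_equiv D E
| sl_R1 D E : reidemeister1 D E -> string_link_equiv D E
| sl_R2 D E : reidemeister2 D E -> string_link_equiv D E
| sl_R3 D E : reidemeister3 D E -> string_link_equiv D E
| sl_refl D : string_link_equiv D D
| sl_sym D E : string_link_equiv D E -> string_link_equiv E D
| sl_trans D E F :
    string_link_equiv D E -> string_link_equiv E F -> string_link_equiv D F.

End Moves.

Section Strings.
Variables (n : nat) (D : diagram n).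
Local Notation st := (step (nxt D)).
Local Notation pre p := ((nxt D)^-1%g p).
Local Notation str := (@string_of n D).

Lemma connect_last p q : connect st p q ->
  p = q \/ [/\ is_xing q, connect st p (pre q) & st (pre q) q].
Proof.
case/connectP=> s; elim/last_ind: s => [|s r _]; first by left.
rewrite rcons_path last_rcons => /andP[ps /[dup] sr /andP[/eqP-> xq]] ->.
right; rewrite permK; split=> //; last by rewrite /step eqxx.
by apply/connectP; exists s.
Qed.

Lemma connect_first p q : connect st p q ->
  p = q \/ st p (nxt D p) /\ connect st (nxt D p) q.
Proof.
case/connectP=> -[|r s] /=; first by left.
move=> /andP[pr rs] e; right; have [/eqP er _] := andP pr.
by rewrite -er; split=> //; apply/connectP; exists s.
Qed.

Lemma connect_inl p i : connect st p (inl i) -> p = inl i.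
Proof. by case/connect_last=> // -[]. Qed.

Lemma connect_back p q r : connect st p r -> connect st q r ->
  connect st p q \/ connect st q p.
Proof.
case/connectP=> s; elim/last_ind: s r => [|s r' IH] r; first by move=> _ ->; right.
rewrite rcons_path last_rcons => /andP[ps sr] -> {r} /connect_last[->|].
  by left; apply/connectP; exists (rcons s r'); rewrite ?rcons_path ?ps ?last_rcons.
case=> _ qr _; have [/eqP er _] := andP sr.
by apply: IH ps _ _; first exact: erefl; rewrite er permK in qr.
Qed.

Lemma connect_forth p q r : connect st p q -> connect st p r ->
  connect st q r \/ connect st r q.
Proof.
case/connectP=> s; elim: s p => [|q' s IH] p /=; first by move=> _ ->; left.
case/andP=> /[dup] pq' /andP[/eqP eq' _] ps eq /connect_first[<-|[_ pr]].
  right; apply: connect_trans (connect1 pq') _.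
  by apply/connectP; exists s.
by apply: (IH q') => //; rewrite eq'.
Qed.

Lemma string_ofP p : connect st (inl (str p)) p.
Proof. exact: (xchooseP (string_cover p)). Qed.

Lemma string_of_unique i p : connect st (inl i) p -> str p = i.
Proof.
move=> ip; have [] := connect_back ip (string_ofP p) => /connect_inl.
  by case.
by case.
Qed.

Lemma string_of_inl i : str (inl i) = i.
Proof. exact/string_of_unique/connect0. Qed.

Lemma string_of_connect p q : connect st p q -> str q = str p.
Proof. by move=> pq; apply/string_of_unique/connect_trans/pq/string_ofP. Qed.

Lemma string_of_pre x : str (inr x) = str (pre (inr x)).
Proof. by apply/string_of_connect/connect1; rewrite /step permKV eqxx. Qed.

Lemma step_acyclic p q : st p q -> ~~ connect st q p.
Proof.
suff acyc s i r : path st (inl i) s -> r = last (inl i) s ->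
    st r (nxt D r) -> ~~ connect st (nxt D r) r.
  move=> pq; have [s ps ep] := connectP (string_ofP p).
  have [/eqP eq _] := andP pq.
  by have := acyc s _ p ps ep; rewrite -eq; apply.
elim/last_ind: s r => [|s t IH] r.
  by move=> _ -> h; apply/negP=> /connect_inl e; rewrite /step e andbF in h.
rewrite rcons_path last_rcons => /andP[ps pt] -> {r} rt; apply/negP=> ct.
have [/eqP et _] := andP pt.
have := IH _ ps (erefl _); rewrite -et => /(_ pt)/negP; apply.
have [e|[_ h _]] := connect_last ct; last first.
  by rewrite {2}et permK in h; apply: connect_trans (connect1 rt) h.
by rewrite (_ : last _ _ = t) ?connect0 //; apply: (@perm_inj _ (nxt D)); rewrite -et e.
Qed.

Definition before p : Lambda n := \sum_(x | connect st (inr x) p) label x.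

Lemma before_inl i : before (inl i) = 0.
Proof. by rewrite /before big_pred0 // => x; apply/negP=> /connect_inl. Qed.

Lemma before_inr x : before (inr x) = before (pre (inr x)) + label x.
Proof.
have px : st (pre (inr x)) (inr x) by rewrite /step permKV eqxx.
rewrite {1}/before (bigD1 x) ?connect0 //= addrC; congr (_ + _).
apply: eq_bigl => y; apply/andP/idP => [[yx ne]|yp].
  have [[e]|[_ //]] := connect_last yx; by rewrite e eqxx in ne.
split; first exact: connect_trans yp (connect1 px).
by apply: contraTneq yp => ->; exact: step_acyclic.
Qed.

Lemma before_edge_x j : before (edge_x D j) = w_exp D j.
Proof.
apply: eq_bigl => x; apply/idP/eqP => [/string_of_connect <- //|e].
have := string_ofP (inr x); rewrite e => /connect_forth/(_ (string_ofP _)).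
case=> // /connect_first[<-|[]]; first exact: connect0.
by rewrite /step permKV andbF.
Qed.

Lemma tau_inj : injective (tau D).
Proof.
move=> j k e; apply: (@inl_inj _ (xing D * bool)); apply: (@perm_inj _ (nxt D)^-1%g).
have := string_ofP (edge_x D j); rewrite -[str _]/(tau D j) e.
move=> /connect_forth/(_ (string_ofP _)).
case=> /connect_first[//|[]]; by rewrite /step permKV andbF.
Qed.

End Strings.

(* A group with a right action of [Lambda_n] by automorphisms. *)
Record Lambda_group (n : nat) := LambdaGroup {
  lg_sort :> groupType;
  lg_act : lg_sort -> Lambda n -> lg_sort;
  lg_act0 : forall g, lg_act g 0 = g;
  lg_actD : forall g w w', lg_act g (w + w') = lg_act (lg_act g w) w';
  lg_actM : forall g h w, lg_act (g * h)%g w = (lg_act g w * lg_act h w)%g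
}.

Definition lg_morphism (n : nat) (G H : Lambda_group n) (f : G -> H) : Prop :=
  (forall g h, f (g * h)%g = (f g * f h)%g) /\
  (forall g w, f (lg_act g w) = lg_act (f g) w).

(* The relations [R s t w] stand for [t = s^w]. *)
Definition satisfies (n : nat) (T : Type) (R : T -> T -> Lambda n -> Prop)
    (G : Lambda_group n) (g : T -> G) : Prop :=
  forall s t w, R s t w -> g t = lg_act (g s) w.

Definition presents (n : nat) (T : Type) (R : T -> T -> Lambda n -> Prop)
    (G : Lambda_group n) (g : T -> G) : Prop :=
  satisfies R g /\
  forall (H : Lambda_group n) (h : T -> H), satisfies R h ->
    (exists f : G -> H, lg_morphism f /\ f \o g =1 h) /\
    (forall f f' : G -> H, lg_morphism f -> lg_morphism f' ->
       f \o g =1 f' \o g -> f =1 f').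

(* [K_n]: at each crossing, both strands. *)
Definition K_rel (n : nat) (D : diagram n) (s t : port n (xing D)) (w : Lambda n) :
    Prop :=
  exists x, [/\ s = (nxt D)^-1%g (inr x), t = inr x & w = label x].

(* The generators [inl i] and [inr j] stand for [a_i] and [x_j]. *)
Definition ax_rel (n : nat) (i : 'I_n -> 'I_n) (w : 'I_n -> Lambda n)
    (s t : 'I_n + 'I_n) (w' : Lambda n) : Prop :=
  exists j, [/\ s = inl (i j), t = inr j & w' = w j].

Definition Ktilde_rel (n : nat) (D : diagram n) := ax_rel (tau D) (@wtilde_exp n D).

Lemma lg_morph_act (n : nat) (G H : Lambda_group n) (f : G -> H) g w :
  lg_morphism f -> f (lg_act g w) = lg_act (f g) w.
Proof. by case. Qed.

Lemma K_edge (n : nat) (D : diagram n) (G : Lambda_group n)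
    (g : port n (xing D) -> G) : satisfies (@K_rel n D) g ->
  forall p, g p = lg_act (g (inl (string_of p))) (before p).
Proof.
move=> sat p; have [s] := connectP (string_ofP p).
move: (string_of p) => i; elim/last_ind: s p => [|s q IH] p.
  by move=> _ ->; rewrite before_inl lg_act0.
rewrite rcons_path last_rcons => /andP[ps /andP[/eqP]].
case: q => [//|x] e _ -> {p}; rewrite before_inr lg_actD.
have ex : (nxt D)^-1%g (inr x) = last (inl i) s by rewrite e permK.
by rewrite -IH // -?ex //; apply: sat; exists x; rewrite ex.
Qed.

(* Eliminating the other generators. *)
Lemma K_eliminate (n : nat) (D : diagram n) (G : Lambda_group n)
    (g : port n (xing D) -> G) :
  presents (@K_rel n D) g ->
  presents (ax_rel (tau D) (@w_exp n D))
    (fun s => match s with inl i => g (@edge_a n D i) | inr j => g (edge_x D j) end).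
Proof.
move=> [sat univ]; split=> [_ _ _ [j [-> -> ->]]|H h hsat].
  by rewrite K_edge // before_edge_x.
pose h' p := lg_act (h (inl (@string_of n D p))) (before p).
have sat' : satisfies (@K_rel n D) h'.
  move=> _ _ _ [x [-> -> ->]].
  by rewrite /h' before_inr lg_actD string_of_pre.
have [[f [fm fg]] uniq_f] := univ H h' sat'; split.
  exists f; split=> // -[i|j] /=; rewrite [f _]fg /h'.
    by rewrite string_of_inl before_inl lg_act0.
  by rewrite before_edge_x; apply/esym/hsat; exists j.
move=> f1 f2 m1 m2 e; apply: uniq_f => // p /=.
rewrite K_edge // !lg_morph_act //; congr lg_act.
exact: (e (inl _)).
Qed.

Section Abelianization.
Variables (n : nat) (G : Lambda_group n).

(* Maps to [Z[Lambda_n]]-modules, [g^w] going to [w] times the image of [g]. *)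
Definition ab_map (A : lmodType (ZLambda n)) (f : G -> A) : Prop :=
  (forall g h, f (g * h)%g = f g + f h) /\
  (forall g w, f (lg_act g w) = (gr_mono w : ZLambda n) *: f g).

Definition abelianization (A : lmodType (ZLambda n)) (ab : G -> A) : Prop :=
  ab_map ab /\
  forall (B : lmodType (ZLambda n)) (f : G -> B), ab_map f ->
    (exists h : {linear A -> B}, h \o ab =1 f) /\
    (forall h h' : {linear A -> B}, h \o ab =1 h' \o ab -> h =1 h').

End Abelianization.

Definition is_basis (R : comNzRingType) (A : lmodType R) (n : nat) (b : 'I_n -> A) :
    Prop :=
  forall x, exists! c : 'rV[R]_n, x = \sum_i c 0 i *: b i.

Section AdditiveGroup.
Variables (n : nat) (A : lmodType (ZLambda n)).

Definition mul_of : Type := A.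
HB.instance Definition _ := Choice.on mul_of.
HB.instance Definition _ := isGroup.Build mul_of
  (@addrA A) (@add0r A) (@addr0 A) (@addNr A) (@addrN A).

Definition mul_act (x : mul_of) (w : Lambda n) : mul_of :=
  (gr_mono w : ZLambda n) *: (x : A).

Lemma mul_act0 x : mul_act x 0 = x. Proof. exact: scale1r. Qed.

Lemma mul_actD x w w' : mul_act x (w + w') = mul_act (mul_act x w) w'.
Proof. by rewrite /mul_act addrC gr_monoD scalerA. Qed.

Lemma mul_actM (x y : mul_of) w :
  mul_act (x * y)%g w = (mul_act x w * mul_act y w)%g.
Proof. exact: scalerDr. Qed.

Definition additive_lg : Lambda_group n :=
  LambdaGroup mul_act0 mul_actD mul_actM.

End AdditiveGroup.

Section ChangeOfBasis.
Variables (n : nat) (D : diagram n).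
Local Notation R := (ZLambda n).
Local Notation mono w := (gr_mono (w : Lambda n) : R).

Lemma is_basis_rescale (A : lmodType R) (b : 'I_n -> A) (t : 'I_n -> 'I_n)
    (w : 'I_n -> Lambda n) : injective t ->
  is_basis b -> is_basis (fun j => mono (w j) *: b (t j)).
Proof.
move=> t_inj bb x; have [c [xc uc]] := bb x.
have [t' tK t'K] := injF_bij t_inj.
have monoV j : mono (- w j) * mono (w j) = 1 by rewrite -gr_monoD addNr.
exists (\row_j (c 0 (t j) * mono (- w j))); split.
  rewrite xc (reindex t) /=; last by exists t' => ? _.
  by apply: eq_bigr => j _; rewrite mxE scalerA -mulrA monoV mulr1.
move=> d xd; have /uc -> : x = \sum_i (\row_i (d 0 (t' i) * mono (w (t' i)))) 0 i *: b i.
  rewrite xd [RHS](reindex t) /=; last by exists t' => ? _.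
  by apply: eq_bigr => j _; rewrite mxE tK scalerA.
by apply/rowP=> j; rewrite !mxE tK -mulrA [_ * mono (- _)]mulrC monoV mulr1.
Qed.

(* [TYM D] is the matrix of the change of basis from [S] to [T] in the
   abelianization of [Ktilde_n]. *)
Lemma TYM_change_of_basis (G : Lambda_group n) (g : 'I_n + 'I_n -> G)
    (A : lmodType R) (ab : G -> A) :
  presents (Ktilde_rel D) g -> abelianization ab ->
  [/\ is_basis (fun i => ab (g (inl i))), is_basis (fun j => ab (g (inr j))) &
      forall j, ab (g (inr j)) = \sum_i TYM D i j *: ab (g (inl i))].
Proof.
move=> [sat univ] [[abM abw] ab_univ].
have abx j : ab (g (inr j)) = mono (wtilde_exp D j) *: ab (g (inl (tau D j))).
  by rewrite -abw; congr ab; apply: sat; exists j.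
have S_basis : is_basis (fun i => ab (g (inl i))).
  pose e s : additive_lg 'rV[R]_n := match s with
    | inl i => delta_mx 0 i
    | inr j => mono (wtilde_exp D j) *: delta_mx 0 (tau D j) end.
  have sat_e : satisfies (Ktilde_rel D) e by move=> _ _ _ [j [-> -> ->]].
  have [[f [[fM fw] fe]] _] := univ _ e sat_e.
  have f_ab : @ab_map n G 'rV[R]_n f by split.
  have [[h hab] _] := ab_univ _ _ f_ab.
  pose k (c : 'rV[R]_n) := \sum_i c 0 i *: ab (g (inl i)).
  have k_lin : linear k.
    move=> a c d; rewrite /k scaler_sumr -big_split; apply: eq_bigr => i _.
    by rewrite !mxE scalerDl scalerA.
  pose kL := GRing.isLinear.Build _ _ _ _ k k_lin.
  pose K : {linear 'rV[R]_n -> A} := HB.pack k kL.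
  have Ke i : k (delta_mx 0 i) = ab (g (inl i)).
    rewrite /k (bigD1 i) //= big1 ?addr0 => [|j ne]; last first.
      by rewrite mxE (negPf ne) andbF scale0r.
    by rewrite mxE !eqxx scale1r.
  have h_a i : h (ab (g (inl i))) = delta_mx 0 i.
    by rewrite -[LHS]/((h \o ab) (g (inl i))) hab -[LHS]/((f \o g) (inl i)) fe.
  pose ab' : G -> additive_lg A := ab.
  have ab_sat : satisfies (Ktilde_rel D) (ab' \o g).
    by move=> _ _ _ [j [-> -> ->]]; exact: abx.
  have [_ uniq_ab] := univ _ _ ab_sat.
  have khab : K \o h \o ab =1 ab.
    apply: (uniq_ab (K \o h \o ab)) => [||[i|j]].
    - split=> [x y|x w].
        rewrite -[LHS]/(K (h (ab (x * y)%g))) abM (linearD h) (linearD K).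
        exact: erefl.
      rewrite -[LHS]/(K (h (ab (lg_act x w)))) abw (linearZZ h) (linearZZ K).
      exact: erefl.
    - by split.
    - by rewrite -[LHS]/(K (h (ab (g (inl i))))) h_a; exact: Ke.
    - rewrite -[LHS]/(K (h (ab (g (inr j))))) -[RHS]/(ab (g (inr j))) abx.
      by rewrite (linearZZ h) (linearZZ K) h_a; congr (_ *: _); exact: Ke.
  have [_ uniq_A] := ab_univ A ab (conj abM abw).
  have kh : K \o h =1 idfun := uniq_A (K \o h) idfun khab.
  move=> x; exists (h x); split; first by rewrite -{1}[x]/(idfun x) -kh.
  move=> c ->; rewrite linear_sum [RHS]row_sum_delta; apply: eq_bigr => i _.
  by rewrite linearZ /= h_a.
split=> // [|j].
  by move=> x; have [c [xc uc]] := is_basis_rescale (wtilde_exp D) (@tau_inj n D) S_basis x;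
     exists c; split=> [|d xd]; [rewrite xc | apply: uc; rewrite xd];
     apply: eq_bigr => j _; rewrite abx.
rewrite abx (bigD1 (tau D j)) //= big1 ?addr0 => [|i ne]; first by rewrite mxE eqxx.
by rewrite mxE (negPf ne) scale0r.
Qed.

Lemma TYM_invertible :
  exists N : 'M[R]_n, TYM D *m N = 1%:M /\ N *m TYM D = 1%:M.
Proof.
have [t tK t'K] := injF_bij (@tau_inj n D).
pose N : 'M[R]_n := \matrix_(j, i)
  if i == tau D j then mono (- wtilde_exp D j) else 0.
exists N; split; apply/matrixP=> i k; rewrite !mxE.
  rewrite (bigD1 (t i)) //= big1 ?addr0 => [|j ne].
    rewrite !mxE t'K eqxx [k == i]eq_sym; case: eqP => _; rewrite ?mulr0 //.
    by rewrite -gr_monoD addrN.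
  by rewrite !mxE; case: eqP => [e|]; rewrite ?mul0r // e tK eqxx in ne *.
rewrite (bigD1 (tau D i)) //= big1 ?addr0 => [|j ne].
  rewrite !mxE eqxx (inj_eq (@tau_inj n D)).
  by case: eqP => [->|_]; rewrite ?mulr0 // -gr_monoD addNr.
by rewrite !mxE (negPf ne) mul0r.
Qed.

End ChangeOfBasis.

(* Main.v *)
(** The exponent of [u] and [v] picked up along a string is a sum over crossings,
    where the crossing of two strings [o] (over) and [m] (under) contributes a
    monomial depending only on its sign, on [o] and on [m]. After the correction
    by the self-writhe, a self-crossing contributes nothing: this disposes of R1.
    The two crossings of an R2 bigon involve the same two strings and have
    opposite signs, and R3 only changes the order of the crossings along the
    strings. In a concatenation the crossings of the lower diagram contribute as
    before, up to the renaming of the strings by [tau]. *)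

Require Import Defs.
From mathcomp Require Import all_boot all_order all_fingroup all_algebra.

Set Implicit Arguments.
Unset Strict Implicit.
Unset Printing Implicit Defensive.

Import GRing.Theory.

Local Open Scope ring_scope.

(** * Crossing weights *)

(* The exponent that string [i] picks up at a positive crossing of string [o]
   over string [m], with the self-writhe correction included. *)
Definition crossing_weight (n : nat) (i o m : 'I_n) : Lambda n :=
  (if o == i then gen_v m else 0) + (if m == i then gen_u o else 0)
  - (if (o == i) && (m == i) then gen_u i + gen_v i else 0).

Lemma crossing_weight_self n (i o : 'I_n) : crossing_weight i o o = 0.
Proof.
rewrite /crossing_weight andbb; case: eqP => [->|_]; last by rewrite subr0 addr0.
by rewrite [gen_v i + _]addrC subrr.
Qed.

Lemma Lambda_act0 n (t : 'I_n -> 'I_n) : Lambda_act t 0 = 0.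
Proof. by apply: (addIr (Lambda_act t 0)); rewrite -Lambda_actD !add0r. Qed.

Lemma Lambda_actN n (t : 'I_n -> 'I_n) : {morph @Lambda_act n t : w / - w}.
Proof.
move=> w; apply: (addIr (Lambda_act t w)).
by rewrite -Lambda_actD !addNr Lambda_act0.
Qed.

Lemma Lambda_actMz n (t : 'I_n -> 'I_n) w (m : int) :
  Lambda_act t (w *~ m) = Lambda_act t w *~ m.
Proof.
have actMn k : Lambda_act t (w *+ k) = Lambda_act t w *+ k.
  by elim: k => [|k IH]; rewrite ?mulr0n ?Lambda_act0 // !mulrS Lambda_actD IH.
by case: m => k; rewrite ?NegzE ?mulrNz ?Lambda_actN -?pmulrn actMn.
Qed.

Lemma ZLambda_act0 n (t : 'I_n -> 'I_n) : ZLambda_act t 0 = 0.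
Proof. by apply: (addIr (ZLambda_act t 0)); rewrite -ZLambda_actD !add0r. Qed.

(** Injectivity of [t] keeps the tests [o == i] and [m == i] unchanged; [tau] has it. *)
Lemma Lambda_act_crossing_weight n (t : 'I_n -> 'I_n) (i o m : 'I_n) :
  injective t ->
  Lambda_act t (crossing_weight i o m) = crossing_weight (t i) (t o) (t m).
Proof.
move=> t_inj; rewrite /crossing_weight !(inj_eq t_inj).
rewrite !Lambda_actD Lambda_actN.
by do ![case: ifP => _];
   rewrite ?Lambda_act0 ?Lambda_actD ?Lambda_act_gen_u ?Lambda_act_gen_v.
Qed.

Section Weights.
Variables (n : nat) (D : diagram n).
Local Notation str := (@string_of n D).

Definition crossing_exp (i : 'I_n) (c : xing D) : Lambda n :=
  crossing_weight i (str (Defs.over c)) (str (Defs.under c)) *~ eps c.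

(** Grouping the two strands at each crossing absorbs the self-writhe correction, so that diagrams
    can be compared crossing by crossing. *)
Lemma wtilde_exp_sum j : wtilde_exp D j = \sum_c crossing_exp (tau D j) c.
Proof.
rewrite /wtilde_exp /w_exp /self_writhe; move: (tau D j) => i.
have -> : \sum_(x | str (inr x) == i) label x =
    \sum_c \sum_(o | str (inr (c, o)) == i) label (c, o).
  by rewrite pair_big_dep; apply: eq_big => -[].
rewrite (raddf_sum (intmul (gen_u i + gen_v i))) [X in _ - X]big_mkcond -sumrB.
apply: eq_bigr => c _; rewrite big_mkcond big_bool /crossing_exp /crossing_weight.
rewrite /label /= -/(Defs.over c) -/(Defs.under c) mulrzBl.
by do ![case: ifP => _]; rewrite ?mulrzDl ?mul0rz.
Qed.

Lemma string_of_nxt p : is_xing (nxt D p) -> str (nxt D p) = str p.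
Proof. by move=> h; apply/string_of_connect/connect1; rewrite /step eqxx. Qed.

Lemma joins_string_of p q r : joins p q r -> is_xing q -> is_xing r ->
  str q = str r.
Proof. by case=> -[-> <-] *; rewrite string_of_nxt. Qed.

End Weights.

(** * Comparison of two diagrams *)

Lemma TYM_ext n (D E : diagram n) : tau D =1 tau E ->
  (forall i, \sum_c crossing_exp (D := D) i c = \sum_c crossing_exp (D := E) i c) ->
  TYM D = TYM E.
Proof.
move=> tDE wDE; apply/matrixP=> i j; rewrite /TYM [LHS]mxE [RHS]mxE tDE.
by rewrite (wtilde_exp_sum D) tDE wDE -(wtilde_exp_sum E).
Qed.

(** A crossing of [E] has the sign and the strings of its image in [D], hence the same exponent; the
    crossings outside the image must cancel. *)
Lemma TYM_embed n (D E : diagram n) (f : xing E -> xing D) :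
  injective f -> (forall c, sgn D (f c) = sgn E c) ->
  (forall p, string_of (port_map f p) = string_of p) -> tau D =1 tau E ->
  (forall i, \sum_(c | c \notin codom f) crossing_exp i c = 0) ->
  TYM D = TYM E.
Proof.
move=> f_inj sgf strf tDE rest; apply: TYM_ext => // i.
rewrite (bigID (mem (codom f))) /= rest addr0.
rewrite -big_uniq; last by rewrite map_inj_uniq ?enum_uniq.
rewrite big_image /=.
by apply: eq_bigr => c _; rewrite /crossing_exp /eps sgf -!(strf (inr _)).
Qed.

(** The string through [p] is given by a path from its initial point [inl i]; [g] carries it to a
    path from [g (inl i)], which lies on string [t i]. *)
Lemma string_of_homo n (D E : diagram n)
    (g : port n (xing E) -> port n (xing D)) (t : 'I_n -> 'I_n) :
  (forall i, string_of (g (inl i)) = t i) ->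
  (forall p q, step (nxt E) p q -> connect (step (nxt D)) (g p) (g q)) ->
  forall p, string_of (g p) = t (string_of p).
Proof.
move=> gi gst p; rewrite -gi; apply: string_of_connect.
have /connectP[s] := string_ofP p; move: (string_of p) => i.
elim/last_ind: s p => [|s q IH] p; first by move=> _ ->; exact: connect0.
rewrite rcons_path last_rcons => /andP[/IH/(_ erefl) ps /gst] + ->.
exact: connect_trans.
Qed.

(** * Erasing crossings: R1 and R2 *)

Section Erasure.
Variables (n : nat) (D E : diagram n) (S : {set xing D}).

Lemma connect_iter_nxt (p : port n (xing D)) k :
  (forall i, (i < k)%N -> is_xing (iter i.+1 (nxt D) p)) ->
  connect (step (nxt D)) p (iter k (nxt D) p).
Proof.
elim: k => [|k IH] h; first exact: connect0.
apply: connect_trans (IH _) (connect1 _) => [i ik|]; first exact/h/leqW.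
by rewrite /step eqxx; exact: h.
Qed.

(** An edge of [E] is a chain of edges of [D] through erased crossings only, so it stays on one
    string of [D]. *)
Lemma erases_TYM : erases S E ->
  (forall i, \sum_(c in S) crossing_exp i c = 0) -> TYM D = TYM E.
Proof.
move=> [f [f_inj inS sgf nxtf]] sumS.
have path_f p : exists2 k,
    connect (step (nxt D)) (port_map f p) (iter k (nxt D) (port_map f p)) &
    nxt D (iter k (nxt D) (port_map f p)) = port_map f (nxt E p).
  have [k [<- h]] := nxtf p; exists k => //; apply: connect_iter_nxt => i /h.
  by move=> [c [o [_ ->]]].
have strf p : string_of (port_map f p) = string_of p.
  apply: (string_of_homo (t := id)) => [i|{}p q /andP[/eqP-> qx]].
    exact: string_of_inl.
  have [k pk e] := path_f p; apply: connect_trans pk (connect1 _).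
  by rewrite /step -e eqxx e; case: (nxt E p) qx => [|[]].
apply: (TYM_embed f_inj sgf strf) => [j|i].
  have [k pk e] := path_f (edge_x E j); rewrite /tau -strf.
  rewrite permKV /= in e.
  by rewrite -(string_of_connect pk) /edge_x -e permK.
rewrite -[RHS](sumS i); apply: eq_bigl => c; apply/idP/idP => [nc|/inS nc].
  by apply/inS => c' e; rewrite -e codom_f in nc.
by apply/codomP=> -[c' /esym/nc].
Qed.

End Erasure.

Lemma reidemeister1_TYM n (D E : diagram n) : reidemeister1 D E -> TYM D = TYM E.
Proof.
move=> [c [o [loop er]]]; apply: (erases_TYM er) => i; rewrite big_set1.
suff e : string_of (Defs.over c) = string_of (Defs.under c).
  by rewrite /crossing_exp e crossing_weight_self mul0rz.
have := string_of_nxt (p := inr (c, o)); rewrite loop => /(_ isT).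
by case: o {loop}.
Qed.

(** By [turn], the walk around the bigon switches between following and opposing the orientation at
    a negative corner when passing from over to under, and at a positive one when passing back. It
    closes up only if the signs differ. *)
Lemma bigon_sgn n (D : diagram n) (c d : xing D) p1 p2 h1 h2 :
  joins p1 (Defs.over c) (Defs.over d) -> joins p2 (Defs.under c) (Defs.under d) ->
  h1 \in sides p1 -> h2 \in sides p2 ->
  face (sgn D) (nxt D) h1 = h2 -> face (sgn D) (nxt D) h2 = h1 ->
  sgn D d = ~~ sgn D c.
Proof.
move=> J1 J2; rewrite !inE !permE /= => H1 H2.
move: J1 J2 H1 H2 => [] [-> e1] [] [-> e2] /orP[]/eqP-> /orP[]/eqP-> /=;
  rewrite /along /= ?permK ?e1 ?e2 /=;
  move=> /(congr1 snd) + /(congr1 snd) /=; by case: (sgn D c); case: (sgn D d).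
Qed.

Lemma reidemeister2_TYM n (D E : diagram n) : reidemeister2 D E -> TYM D = TYM E.
Proof.
move=> [c [d [p1 [p2 [cd [J1 J2] [h1 [h2 [s1 s2 f1 f2]]] er]]]]].
apply: (erases_TYM er) => i; rewrite big_setU1 ?inE // big_set1.
rewrite /crossing_exp (joins_string_of J1) // (joins_string_of J2) //.
rewrite /= -mulrzDr /eps (bigon_sgn J1 J2 s1 s2 f1 f2).
by case: (sgn D c); rewrite /= ?addrN ?addNr mulr0z.
Qed.

(** * Permuting ports: isotopy and R3 *)

(** Since [s] moves ports only within their string, each layer of each crossing keeps its string. *)
Lemma TYM_conjugate n (D E : diagram n) (f : xing D -> xing E)
    (s : {perm port n (xing D)}) :
  bijective f -> (forall c, sgn E (f c) = sgn D c) ->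
  (forall i, s (inl i) = inl i) -> (forall p, is_xing p -> is_xing (s p)) ->
  (forall p, string_of (s p) = string_of p) ->
  (forall p, nxt E (port_map f (s p)) = port_map f (s (nxt D p))) ->
  TYM D = TYM E.
Proof.
move=> f_bij sgf s_inl s_xing s_str nxtf; apply/esym.
have strf p : string_of (port_map f p) = string_of p.
  rewrite -[p](permKV s) s_str; move: (s^-1 p)%g => {}p.
  apply: (string_of_homo (g := port_map f \o s) (t := id)) => [i|{}p q].
    by rewrite /= s_inl string_of_inl.
  move=> /andP[/eqP-> qx]; apply: connect1; rewrite /step /= nxtf eqxx.
  by case: (s _) (s_xing _ qx) => [|[]].
apply: (TYM_embed (bij_inj f_bij) sgf strf) => [j|i].
  have e : edge_x E j = port_map f (s (edge_x D j)).
    by apply: (@perm_inj _ (nxt E)); rewrite nxtf !permKV s_inl.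
  by rewrite /tau e strf s_str.
rewrite big_pred0 // => c; have [g _ fK] := f_bij.
by apply/negbTE; rewrite negbK -(fK c) codom_f.
Qed.

Lemma planar_isotopic_TYM n (D E : diagram n) : planar_isotopic D E -> TYM D = TYM E.
Proof.
move=> [f [f_bij sgf nxtf]].
by apply: (TYM_conjugate (s := 1%g) f_bij sgf) => p; rewrite !perm1.
Qed.

(** Each transposition exchanges the ends of an edge of the triangle, which lie on the same
    string. *)
Lemma reidemeister3_TYM n (D E : diagram n) : reidemeister3 D E -> TYM D = TYM E.
Proof.
move=> [a [b [c [p1 [p2 [p3 [_ [J1 J2 J3] _ /= [f [f_bij sgf nxtf]]]]]]]]].
have xing_tperm p (x y : port n (xing D)) :
    is_xing x -> is_xing y -> is_xing (tperm x y p) = is_xing p.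
  by move=> xx xy; case: tpermP => [->|->|//]; rewrite xx xy.
have str_tperm p (x y : port n (xing D)) :
    string_of x = string_of y -> string_of (tperm x y p) = string_of p.
  by move=> xy; case: tpermP => [->|->|//].
apply: (TYM_conjugate f_bij sgf) nxtf => [i|p|p]; rewrite !permM.
- by rewrite !tpermD.
- by rewrite !xing_tperm.
- by rewrite !str_tperm // ?(joins_string_of J1) ?(joins_string_of J2) ?(joins_string_of J3).
Qed.

(** * Concatenation *)

Section Concatenation.
Variables (n : nat) (D E : diagram n).
Local Notation DE := (cat_diagram D E).

Lemma string_of_portl p : @string_of n DE (portl E p) = string_of p.
Proof.
apply: (@string_of_homo n DE D (portl E) id) => [i|{}p q /step_portl pq].
  exact: (@string_of_inl n DE).
exact: connect1 (pq E).
Qed.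

(** The string of [E] starting at the point [k] continues the string of [D] that ends there, namely
    [tau D k]. *)
Lemma string_of_edger p : @string_of n DE (edger D p) = tau D (string_of p).
Proof.
apply: (@string_of_homo n DE E (@edger n D E) (tau D)) => [i|{}p q /step_edger pq].
  exact: string_of_portl.
exact: connect1 (pq D).
Qed.

Lemma tau_cat j : tau DE j = tau D (tau E j).
Proof.
have e : edge_x DE j = edger D (edge_x E j).
  by apply: (@perm_inj _ (cat_next D E)); rewrite cat_next_edger !permKV.
by rewrite {1}/tau e string_of_edger.
Qed.

Lemma wtilde_exp_cat j :
  wtilde_exp DE j = wtilde_exp D (tau E j) + Lambda_act (tau D) (wtilde_exp E j).
Proof.
rewrite !wtilde_exp_sum tau_cat big_sumType /=; congr (_ + _).
  apply: eq_bigr => c _; rewrite /crossing_exp.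
  by rewrite -(string_of_portl (inr (c, true))) -(string_of_portl (inr (c, false))).
have actD := big_morph (Lambda_act (tau D)) (@Lambda_actD n _) (Lambda_act0 _).
rewrite actD; apply: eq_bigr => c _; rewrite /crossing_exp Lambda_actMz.
rewrite Lambda_act_crossing_weight; last exact: tau_inj.
by rewrite -!string_of_edger.
Qed.

End Concatenation.

Theorem theorem3p12 (n : nat) (n_ge1 : (1 <= n)%N) :
  (forall L L' : diagram n, string_link_equiv L L' -> TYM L = TYM L') /\
  (forall L L' : diagram n,
     TYM (cat_diagram L L') = TYM L *m sl_act L (TYM L')).
Proof.
split=> L L'.
  elim=> {L L'} [D E|D E|D E|D E|//|D E _ -> //|D E F _ -> _ -> //].
  - exact: planar_isotopic_TYM.
  - exact: reidemeister1_TYM.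
  - exact: reidemeister2_TYM.
  - exact: reidemeister3_TYM.
(* Column [j] of [TYM L'] vanishes outside row [tau L' j], which leaves a single term of the
   product. *)
apply/matrixP=> i j; rewrite !mxE (bigD1 (tau L' j)) //= big1 => [|k ne].
  rewrite !mxE eqxx addr0 tau_cat; case: eqP => _; last by rewrite mul0r.
  by rewrite [ZLambda_act _ _]ZLambda_act_mono -gr_monoD wtilde_exp_cat.
by rewrite !mxE (negPf ne) ZLambda_act0 mulr0.
Qed.
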